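(* Let $k$ be a positive integer and $D$ be a digraph with vertices partitioned into bicliques $C_1,\dots,C_r$. If for every $i\in\{1,\dots,r\}$ and every $v\in C_i$, $v$ has at most $k$ out-neighbours outside $C_i$ and at most $|C_i|-k$ in-neighbours outside $C_i$, then $D$ contains an acyclic set of size $r$.
   Context: Digraphs are finite, without loops and without parallel arcs (two opposite arcs $uv$ and $vu$ are allowed and form a digon). A biclique of $D$ is a set of vertices that are pairwise linked by two arcs in opposite directions. The parts of a partition are nonempty. An acyclic set is a set of vertices inducing a subdigraph without directed cycles (a digon is a directed cycle of length 2). *)

(* Defs.v *)
(* A digraph is an irreflexive [arc : rel T] on a finite type of
   vertices: a relation has no parallel arcs, and [arc u v], [arc v u] may
   hold together (a digon). *)
From mathcomp Require Import all_boot.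

Set Implicit Arguments.
Unset Strict Implicit.
Unset Printing Implicit Defensive.

Definition biclique (T : finType) (arc : rel T) (B : {set T}) : Prop :=
  {in B &, forall u v, u != v -> arc u v && arc v u}.

Definition outneigh (T : finType) (arc : rel T) (v : T) : {set T} :=
  [set w | arc v w].

Definition inneigh (T : finType) (arc : rel T) (v : T) : {set T} :=
  [set w | arc w v].

(* [ucycle arc c] lists the distinct vertices of a directed cycle in order.
   It also holds of [::], which is excluded; a one-vertex cycle would be a
   loop, so in a digraph the shortest cycles are the digons. *)
Definition dicycle (T : finType) (arc : rel T) (c : seq T) : Prop :=
  c <> [::] /\ ucycle arc c.

Definition acyclic_set (T : finType) (arc : rel T) (S : {set T}) : Prop :=
  ~ exists c : seq T, dicycle arc c /\ {subset c <= S}.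

(* Main.v *)
Require Import Defs.
From mathcomp Require Import all_boot.

Set Implicit Arguments.
Unset Strict Implicit.
Unset Printing Implicit Defensive.

(** The acyclic set is found as a set with one vertex in each part; then only
    arcs between different parts matter, and the argument is a directed form
    of the alternating search that proves Haxell's theorem on independent
    transversals.  The parts are the fibres ([class]) of a map [f].

    Let M be an acyclic set with at most one vertex in each class, missing
    class c.  If a vertex v of class c has no out-neighbour in M, then v is a
    sink of v + M, no cycle passes through it, and M grows.  If it has some,
    call them the hits of v, one tries to remove them: a vertex v' in the
    class of a hit w that has no out-neighbour in M can replace w in M, again
    as a sink, and if v' is not itself an out-neighbour of v then v has lost
    one hit.  If v' has hits, the search goes on with these, and so on.  Thus
    one builds a list of vertices whose sets of hits are nonempty and, by the
    choice of the vertices, pairwise disjoint.  A next vertex x must be in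
    class c or in the class of a hit, must not be an out-neighbour of an
    earlier vertex (so that moving x into M creates no hit), and must not be
    an in-neighbour of a hit (so that its hits are new).

    Such an x exists by counting ([card_blocked], [card_region]).  A listed
    vertex forbids at most k out-neighbours and each hit w at most
    |class of w| - k in-neighbours.  As every listed vertex has a hit, its k is
    paid for by one of its hits, so at most the total size of the classes of
    the hits is forbidden, and the nonempty class c comes on top of these.

    The search ends ([search_improves]): appending a vertex with hits enlarges
    the set of hits inside M, and a replacement keeps the hits of the vertices
    listed before some v and removes a hit of v, a lexicographic descent. *)

(** * Sinks and acyclic sets *)

Lemma acyclic_setS (T : finType) (arc : rel T) (A B : {set T}) :
  A \subset B -> acyclic_set arc B -> acyclic_set arc A.
Proof.
move=> /subsetP sAB acB [c [cyc sc]]; apply: acB; exists c; split=> //.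
by move=> x /sc /sAB.
Qed.

(** A cycle through v would leave v by an arc to another vertex of M. *)
Lemma acyclic_setU1_sink (T : finType) (arc : rel T) (M : {set T}) (v : T) :
  irreflexive arc -> acyclic_set arc M -> [disjoint outneigh arc v & M] ->
  acyclic_set arc (v |: M).
Proof.
move=> irr acM dis [c [[c0 uc] sc]].
have [vc | vNc] := boolP (v \in c); last first.
  apply: acM; exists c; split=> // x xc.
  by have := sc x xc; rewrite in_setU1; case: eqP => // xv; rewrite -xv xc in vNc.
have arcn := next_cycle (ucycle_cycle uc) vc.
have := sc (next c v); rewrite mem_next => /(_ vc).
rewrite in_setU1 => /predU1P [nv | nM]; first by rewrite nv irr in arcn.
by have := disjointFr dis (x := next c v); rewrite inE arcn nM => /(_ isT).
Qed.

(** In a search the most recent vertex is at the head, so this finds the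
    earliest vertex satisfying [a]. *)
Lemma split_last_has (A : Type) (a : pred A) (s : seq A) : has a s ->
  exists s2 u s1, [/\ s = s2 ++ u :: s1, a u & ~~ has a s1].
Proof.
elim: s => //= x s IH; have [/IH [s2 [u [s1 [-> au nas]]]] _ | nas] := boolP (has a s).
  by exists (x :: s2), u, s1.
by rewrite orbF => ax; exists [::], x, s.
Qed.

(** * Searches and their blocked vertices *)

Section Transversal.

Variables (T I : finType) (f : T -> I) (arc : rel T) (k : nat).

Definition class (i : I) : {set T} := [set x | f x == i].

Definition out_other (v : T) : {set T} := [set w | arc v w & f w != f v].
Definition in_other (v : T) : {set T} := [set w | arc w v & f w != f v].

Lemma in_otherE v w : (v \in in_other w) = (w \in out_other v).
Proof. by rewrite !inE eq_sym. Qed.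

Definition acyclic_choice (M : {set T}) : Prop :=
  acyclic_set arc M /\ {in M &, injective f}.

Definition hit (M : {set T}) (v : T) : {set T} := out_other v :&: M.

Definition hits (M : {set T}) (s : seq T) : {set T} :=
  \bigcup_(v <- s) hit M v.

(** The hits themselves are blocked, as out-neighbours of vertices of [s], and
    so is each vertex of [s] that has a hit, as an in-neighbour of it: hence a
    search lists no vertex twice and no hit. *)
Definition blocked (M : {set T}) (s : seq T) : {set T} :=
  (\bigcup_(v <- s) out_other v) :|: \bigcup_(w in hits M s) in_other w.

Definition region (c : I) (M : {set T}) (s : seq T) : {set T} :=
  [set x | f x \in c |: f @: hits M s].

(** The head of the list is the vertex found last: each vertex is chosen with
    respect to those that follow it. *)
Fixpoint search (c : I) (M : {set T}) (s : seq T) : Prop :=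
  if s is v :: s' then
    [/\ search c M s', v \in region c M s' :\: blocked M s' & hit M v != set0]
  else True.

Lemma hitsP M s w : reflect (exists2 u, u \in s & w \in hit M u) (w \in hits M s).
Proof.
rewrite /hits; elim: s => [|u s IH].
  by rewrite big_nil inE; constructor=> -[].
rewrite big_cons in_setU; apply: (iffP orP).
  case=> [wu | /IH [x xs wx]]; first by exists u; rewrite ?mem_head.
  by exists x; rewrite // in_cons xs orbT.
case=> x; rewrite in_cons => /predU1P [-> |xs] wx; first by left.
by right; apply/IH; exists x.
Qed.

Lemma hits_sub M s : hits M s \subset M.
Proof. by apply/subsetP=> w /hitsP [u _]; rewrite in_setI => /andP []. Qed.

(** The two effects of avoiding [blocked]: adding v to M gives no vertex of s
    a further hit, and the hits of v are new. *)
Lemma notin_blocked M s v : v \notin blocked M s ->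
  (forall u, u \in s -> v \notin out_other u) /\ [disjoint hit M v & hits M s].
Proof.
rewrite in_setU negb_or => /andP [vo vi]; split=> [u us|].
  apply: contra vo => vu; elim: s us {vi} => // x s IH.
  rewrite big_cons in_cons in_setU => /predU1P [<- | /IH ->]; last exact: orbT.
  by rewrite vu.
rewrite disjoint_subset; apply/subsetP=> w; rewrite in_setI => /andP [wv _].
rewrite !inE; apply: contra vi => ws; apply/bigcupP; exists w => //.
by rewrite in_otherE.
Qed.

Lemma eq_hits M M' s : {in s, hit M' =1 hit M} -> hits M' s = hits M s.
Proof. exact: eq_big_seq. Qed.

(** Validity of a search depends on M only through the hits of its vertices,
    so it survives the replacements made further along the search. *)
Lemma eq_search c M M' s : {in s, hit M' =1 hit M} ->
  search c M s -> search c M' s.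
Proof.
elim: s => //= v s IH e [cs vs v0].
have es : {in s, hit M' =1 hit M} by move=> u us; apply: e; rewrite in_cons us orbT.
split; [exact: IH | by rewrite /region /blocked (eq_hits es) | by rewrite e ?mem_head].
Qed.

Lemma card_region c (M : {set T}) s : {in M &, injective f} -> c \notin f @: M ->
  #|region c M s| = #|class c| + \sum_(w in hits M s) #|class (f w)|.
Proof.
move=> injM cM; have sM := subsetP (hits_sub M s).
rewrite -sum1_card (partition_big f [in c |: f @: hits M s]) /=; last first.
  by move=> x; rewrite inE.
have E i : i \in c |: f @: hits M s ->
    \sum_(x in region c M s | f x == i) 1 = #|class i|.
  move=> iA; rewrite -sum1_card; apply: eq_bigl => x; rewrite [RHS]inE inE.
  by case: eqP => [->|]; rewrite ?andbF // iA.
rewrite (eq_bigr _ E) big_setU1 /=; last first.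
  by apply: contra cM => /imsetP [w /sM wM ->]; apply: imset_f.
by rewrite big_imset //= => x y /sM xM /sM yM; apply: injM.
Qed.

(** * Counting *)

Hypothesis out_le : forall v, #|out_other v| <= k.
Hypothesis in_le : forall v, #|in_other v| + k <= #|class (f v)|.

(** The hits of distinct vertices of s are disjoint, so each vertex v of s can
    charge its k out-neighbours to one of its own hits w, for which
    |in_other w| + k <= |class of w|. *)
Lemma card_blocked c M s : search c M s ->
  #|blocked M s| <= \sum_(w in hits M s) #|class (f w)|.
Proof.
have leU (A B : {set T}) m n : #|A| <= m -> #|B| <= n -> #|A :|: B| <= m + n.
  by move=> Am Bn; apply: leq_trans (leq_card_setU A B) (leq_add Am Bn).
elim: s => [_|v s IH /= [/IH {}IH]].
  by rewrite /blocked /hits !big_nil big_set0 setU0 cards0.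
rewrite in_setD => /andP [/notin_blocked [_ dis] _] v0.
have hE : hits M (v :: s) = hit M v :|: hits M s by rewrite /hits big_cons.
rewrite hE (eq_bigl [predU hit M v & hits M s]) => [|w]; last by rewrite !inE.
rewrite bigU //=.
have -> : blocked M (v :: s) =
    (out_other v :|: \bigcup_(w in hit M v) in_other w) :|: blocked M s.
  by rewrite /blocked hE bigcup_setU big_cons setUACA.
apply: (leU) => //; have /set0Pn [w wv] := v0.
(* The chosen hit w pays for [out_other v]; the other hits have k to spare. *)
rewrite (bigD1 w) //= [leqRHS](bigD1 w) //= setUCA.
rewrite setUA (leq_trans (leq_card_setU _ _)) //; apply: leq_add.
  exact: leq_trans (leU _ _ _ _ (leqnn _) (out_le v)) (in_le w).
elim/big_rec2: _ => [|x m A _ Am]; first by rewrite cards0.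
by apply: leU => //; apply: leq_trans (leq_addr k _) (in_le x).
Qed.

Lemma search_step c (M : {set T}) s : c \in f @: [set: T] ->
  {in M &, injective f} -> c \notin f @: M -> search c M s ->
  exists v, v \in region c M s :\: blocked M s.
Proof.
move=> /imsetP [x _ cx] injM cM sch; apply/set0Pn; rewrite -card_gt0.
have := card_blocked sch; rewrite cardsD subn_gt0 => leB.
apply: leq_ltn_trans (subset_leq_card (subsetIr _ _)) _.
apply: leq_ltn_trans leB _; rewrite card_region // -[ltnLHS]add0n ltn_add2r.
by rewrite card_gt0; apply/set0Pn; exists x; rewrite inE cx.
Qed.

(** * Improving a choice *)

Hypothesis arc_irr : irreflexive arc.

(** The class of v is disjoint from M, so the absence of hits, which concerns
    other classes only, already makes v a sink. *)
Lemma acyclic_choiceU1 (M : {set T}) v : acyclic_choice M -> f v \notin f @: M ->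
  hit M v = set0 -> acyclic_choice (v |: M).
Proof.
move=> [acM injM] vM v0; split.
  apply: acyclic_setU1_sink => //; rewrite disjoint_subset; apply/subsetP=> w.
  rewrite !inE => vw; apply: contraNN vM => wM.
  have [<- | neq] := eqVneq (f w) (f v); first exact: imset_f.
  by have := in_set0 w; rewrite -v0 !inE vw neq wM.
move=> x y /setU1P [-> | xM] /setU1P [-> | yM] //; last exact: injM.
  by move=> e; rewrite e imset_f in vM.
by move=> e; rewrite -e imset_f in vM.
Qed.

Definition extends (c : I) (M M' : {set T}) : Prop :=
  acyclic_choice M' /\ f @: M' = c |: f @: M.

(** Progress when M cannot be enlarged: M' is lexicographically smaller than M
    for the numbers of hits of the vertices of s, read from the end of s.
    This is impossible for an empty s. *)
Definition relieves (M : {set T}) (s : seq T) (M' : {set T}) : Prop :=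
  [/\ acyclic_choice M', f @: M' = f @: M &
      exists s2 v s1, [/\ s = s2 ++ v :: s1, {in s1, hit M' =1 hit M}
                        & hit M' v \proper hit M v]].

(** A new vertex v without hits enters M.  If it is not in the missing class,
    it takes the place of a hit w, and the vertex relieved is the earliest one
    that has w as a hit. *)
Lemma swap c M s v : acyclic_choice M -> c \notin f @: M ->
  v \in region c M s :\: blocked M s -> hit M v = set0 ->
  exists M', extends c M M' \/ relieves M s M'.
Proof.
move=> chM cM /setDP [vr /notin_blocked [vo _]] v0.
move: vr; rewrite inE => /setU1P [vc | /imsetP [w ws vw]].
  exists (v |: M); left; split; last by rewrite imsetU1 vc.
  by apply: acyclic_choiceU1; rewrite ?vc.
have wM := subsetP (hits_sub M s) w ws; have [acM injM] := chM.
have vM' : f v \notin f @: (M :\ w).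
  apply/imsetP=> -[x /setD1P [xw xM]]; rewrite vw => /injM e.
  by rewrite e ?eqxx in xw.
exists (v |: (M :\ w)); right; split.
- apply: acyclic_choiceU1 => //.
    split; first exact: acyclic_setS (subsetDl _ _) acM.
    by apply: sub_in2 injM => x /setD1P [].
  by apply/eqP; rewrite -subset0 -v0 setIS // subsetDl.
- by rewrite imsetU1 vw -imsetU1 setD1K.
have /split_last_has [s2 [u [s1 [sE wu nw]]]] : has (fun u => w \in hit M u) s.
  by have [u us wu] := hitsP _ _ _ ws; apply/hasP; exists u.
have hitE x : x \in s -> hit (v |: (M :\ w)) x = hit M x :\ w.
  move=> /vo vx; apply/setP=> y; rewrite !(in_setI, in_setU1, in_setD1).
  have [-> | _] := eqVneq y v; first by rewrite (negPf vx) andbF.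
  by rewrite /= andbCA.
exists s2, u, s1; split=> // [x x1|].
  rewrite hitE; last by rewrite sE mem_cat in_cons x1 !orbT.
  apply/setP=> y; rewrite in_setD1; case: eqP => // -> /=.
  by apply/esym/negbTE; apply: contra nw => wx; apply/hasP; exists x.
by rewrite hitE ?sE ?mem_cat ?mem_head ?orbT // properD1.
Qed.

(** The outer induction is on the number of vertices of M that are not yet
    hits, which bounds how often the search can be prolonged.  For a new
    vertex v, the search prolonged by v improves M; if the improvement
    relieves v itself, it leaves the search s valid, and the inner induction,
    on the number of hits of v, starts again with fewer hits. *)
Lemma search_improves c M s : c \in f @: [set: T] -> acyclic_choice M ->
  c \notin f @: M -> search c M s ->
  exists M', extends c M M' \/ relieves M s M'.
Proof.
move=> cT; have [m] := ubnP (#|M| - #|hits M s|).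
elim: m M s => // m IHm M s; rewrite ltnS => lem chM cM sch.
have [v vr] := search_step cT chM.2 cM sch.
have [n] := ubnP #|hit M v|.
elim: n M chM cM sch vr lem => // n IHn M chM cM sch vr lem; rewrite ltnS => len.
have [v0 | v0] := eqVneq (hit M v) set0; first exact: swap chM cM vr v0.
have sch' : search c M (v :: s) by [].
have lth : #|hits M s| < #|hits M (v :: s)|.
  have /setDP [_ /notin_blocked [_ dis]] := vr.
  have -> : hits M (v :: s) = hit M v :|: hits M s by rewrite /hits big_cons.
  by rewrite cardsU disjoint_setI0 // cards0 subn0 -[ltnLHS]add0n ltn_add2r card_gt0.
have [|M1 [ext | [ch1 f1 [s2 [u [s1 [sE e1 pr]]]]]]] := IHm M (v :: s) _ chM cM sch'.
- apply: leq_trans lem; apply: ltn_sub2l => //.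
  exact: leq_trans lth (subset_leq_card (hits_sub _ _)).
- by exists M1; left.
(* With s2 empty the relieved vertex is v; otherwise it belongs to s. *)
case: s2 sE => [[? ?]|x s2 [_ sE]]; last first.
  by exists M1; right; split=> //; exists s2, u, s1.
subst u s1; have eM1 := eq_hits e1.
have cardM1 : #|M1| = #|M|.
  by rewrite -(card_in_imset ch1.2) -(card_in_imset chM.2) f1.
have [| | | | |M2 [[ch2 f2] | [ch2 f2 [s2 [u [s1 [sE e2 pr2]]]]]]] := IHn M1 ch1.
- by rewrite f1.
- exact: eq_search sch.
- by rewrite /region /blocked eM1.
- by rewrite eM1 cardM1.
- exact: leq_trans (proper_card pr) len.
- by exists M2; left; split; rewrite // f2 f1.
exists M2; right; split; rewrite ?f2 //.
have ss x : x \in u :: s1 -> x \in s by rewrite sE mem_cat orbC => ->.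
exists s2, u, s1; split=> // [x x1|].
  by rewrite e2 ?e1 // ss // in_cons x1 orbT.
by rewrite -[hit M u]e1 // ss ?mem_head.
Qed.

Lemma exists_acyclic_choice (A : {set I}) : A \subset f @: [set: T] ->
  exists2 M, acyclic_choice M & f @: M = A.
Proof.
have [n] := ubnP #|A|; elim: n A => // n IH A; rewrite ltnS => leA sA.
have [-> | /set0Pn [c cA]] := eqVneq A set0.
  exists set0; last exact: imset0.
  split; last by move=> x y; rewrite in_set0.
  case=> -[|x c] [[//= _ _] sub].
  by have := sub x (mem_head _ _); rewrite in_set0.
have [||M chM fM] := IH (A :\ c).
- by apply: leq_trans leA; rewrite [ltnRHS](cardsD1 c) cA.
- exact: subset_trans (subsetDl _ _) sA.
have cM : c \notin f @: M by rewrite fM setD11.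
have [M' [[chM' fM'] | [_ _ [s2 [v [s1 []]]]]]] :=
  search_improves (s := [::]) (subsetP sA c cA) chM cM Logic.I.
  by exists M'; rewrite // fM' fM setD1K.
by case: s2.
Qed.

End Transversal.

(* The in-degree bound  d <= |C| - k  is written  d + k <= |C|, because
   subtraction on nat is truncated at 0. *)
Theorem theorem5p3 (k : nat) (k_gt0 : 0 < k)
  (T : finType) (arc : rel T) (arc_irr : irreflexive arc)
  (r : nat) (P : {set {set T}})
  (partP : partition P [set: T]) (cardP : #|P| = r)
  (bicliqueP : forall C : {set T}, C \in P -> biclique arc C)
  (degP : forall (C : {set T}) (v : T), C \in P -> v \in C ->
    #|outneigh arc v :\: C| <= k /\ #|inneigh arc v :\: C| + k <= #|C|) :
  exists S : {set T}, acyclic_set arc S /\ #|S| = r.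
Proof.
have /and3P [/eqP covP trivP P0] := partP.
(* [pblock P] is the map whose classes are the parts of P. *)
have covE x : x \in cover P by rewrite covP in_setT.
have bE x y : (pblock P y == pblock P x) = (y \in pblock P x).
  by rewrite eq_sym eq_pblock.
have classE x : class (pblock P) (pblock P x) = pblock P x.
  by apply/setP=> y; rewrite inE bE.
have imP : pblock P @: [set: T] = P.
  apply/setP=> C; apply/imsetP/idP=> [[x _ ->] | CP]; first exact: pblock_mem.
  have /set0Pn [x xC] : C != set0 by apply: contraNneq P0 => <-.
  by exists x; rewrite // (def_pblock trivP CP xC).
have deg x := degP _ x (pblock_mem (covE x)) (etrans (mem_pblock P x) (covE x)).
have [x | x | | S [acS injS] fS] :=
    @exists_acyclic_choice _ _ (pblock P) arc k _ _ arc_irr P.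
- rewrite (_ : out_other _ _ _ = outneigh arc x :\: pblock P x); first exact: (deg x).1.
  by apply/setP=> y; rewrite !inE bE andbC.
- rewrite classE (_ : in_other _ _ _ = inneigh arc x :\: pblock P x).
    exact: (deg x).2.
  by apply/setP=> y; rewrite !inE bE andbC.
- by rewrite imP.
by exists S; split; rewrite // -cardP -fS card_in_imset.
Qed.
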